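(* Let $N\ge M\ge 2$ be integers, let $\pmb H=[\pmb h_1,\dots,\pmb h_M]\in\mathbb C^{N\times M}$ have nonzero columns, let $\sigma^2>0$, $\pmb y\in\mathbb C^N$, and let $l_{a,1},\dots,l_{a,M}\in\mathbb R$ be the a priori log-likelihood ratios. Consider the forward and backward log-likelihood-ratio recursions for binary input on the ring of nodes $\{1,\dots,M\}$ (indices modulo $M$), $$l_{j-1\to j}=l_{a,j}+4y^{(R)}_{j|j-1}-\zeta\big(l_{j-2\to j-1}+2d_{j|j-1};\,c_{j|j-1}\big),$$ $$l_{j+1\to j}=l_{a,j}+4y^{(R)}_{j|j+1}-\zeta\big(l_{j+2\to j+1}+2d_{j|j+1};\,c_{j|j+1}\big),$$ with the quantities defined in the context, where one iteration means one complete turn of the recursion along the ring. Then each of the forward and the backward recursion converges to a unique fixed point as the number of iterations goes to infinity. That is, for every $j$, each of the one-turn maps $g_{T,j}$ (forward) and $\tilde g_{T,j}$ (backward) from $\mathbb R$ to $\mathbb R$ has a unique fixed point, and for every initial value $l^{(0)}\in\mathbb R$ the sequence $l^{(k)}=g_{T,j}(l^{(k-1)})$ (respectively $l^{(k)}=\tilde g_{T,j}(l^{(k-1)})$) converges to that fixed point as $k\to\infty$.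
   Context: Indices of nodes are taken in $\{1,\dots,M\}$ modulo $M$. For $\Phi\subset\{1,\dots,M\}$ put $\pmb K_\Phi=\sigma^2\pmb I+\sum_{k\notin\Phi}\pmb h_k\pmb h_k^H$. For $i\ne j$ define $\pmb w_{j|i}=\pmb K_{\{j,i\}}^{-1}\pmb h_j$, $y_{j|i}=\pmb w_{j|i}^H\pmb y$, $a_{j|i,k}=\pmb h_j^H\pmb K_{\{j,i\}}^{-1}\pmb h_k$ for $k\in\{i,j\}$, $\sigma_{j|i}^2=\pmb h_j^H\pmb K_{\{j,i\}}^{-1}\pmb h_j=a_{j|i,j}>0$, and $$y^{(R)}_{j|i}=\Re[y_{j|i}],\qquad c_{j|i}=\frac{2}{\sigma_{j|i}^2}\Re[a_{j|i,j}^*a_{j|i,i}]=2\Re[a_{j|i,i}],\qquad d_{j|i}=\frac{2}{\sigma_{j|i}^2}\Re[a_{j|i,i}^*y_{j|i}].$$ For real $x,c$, $$\zeta(x;c)=-\log\left(\frac{e^{x/2-c}+e^{-x/2+c}}{e^{x/2+c}+e^{-x/2-c}}\right).$$ Forward one-turn map: with $g_j(l)=l_{a,j}+4y^{(R)}_{j|j-1}-\zeta(l+2d_{j|j-1};c_{j|j-1})$, set $g_{T,j}=g_j\circ g_{j-1}\circ\cdots\circ g_1\circ g_M\circ\cdots\circ g_{j+1}$, so that the message $l_{j-1\to j}$ after $k$ iterations satisfies $l_{j-1\to j}^{(k)}=g_{T,j}(l_{j-1\to j}^{(k-1)})$. Backward one-turn map: with $\tilde g_j(l)=l_{a,j}+4y^{(R)}_{j|j+1}-\zeta(l+2d_{j|j+1};c_{j|j+1})$,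 set $\tilde g_{T,j}=\tilde g_j\circ\tilde g_{j+1}\circ\cdots\circ\tilde g_M\circ\tilde g_1\circ\cdots\circ\tilde g_{j-1}$, so that $l_{j+1\to j}^{(k)}=\tilde g_{T,j}(l_{j+1\to j}^{(k-1)})$. *)

(* Defs.v *)
From mathcomp Require Import all_boot all_order all_algebra.
From mathcomp Require Import all_classical all_reals all_analysis.
From mathcomp Require Import complex.

Set Implicit Arguments.
Unset Strict Implicit.
Unset Printing Implicit Defensive.

Import Order.TTheory GRing.Theory Num.Theory.
Import numFieldNormedType.Exports.
Local Open Scope ring_scope.
Local Open Scope complex_scope.
Local Open Scope sesquilinear_scope.
Local Open Scope classical_set_scope.

(* The nodes of the ring are 'I_M, that is {0, .., M - 1} in place of
   {1, .., M}; [ordS] and [ord_pred] are successor and predecessor modulo M. *)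

Definition zeta (R : realType) (x c : R) : R :=
  - ln ((expR (x / 2 - c) + expR (- x / 2 + c))
        / (expR (x / 2 + c) + expR (- x / 2 - c))).

(* [sigma2] is the noise variance $\sigma^2$ itself, not its square root. *)
Definition covmx (R : realType) (N M : nat) (H : 'M[R[i]]_(N, M)) (sigma2 : R)
    (Phi : {set 'I_M}) : 'M[R[i]]_N :=
  (sigma2%:C)%:M + \sum_(k | k \notin Phi) col k H *m (col k H)^t*.

Definition filter_vec (R : realType) (N M : nat) (H : 'M[R[i]]_(N, M))
    (sigma2 : R) (j i : 'I_M) : 'cV[R[i]]_N :=
  invmx (covmx H sigma2 [set j; i]) *m col j H.

Definition obs (R : realType) (N M : nat) (H : 'M[R[i]]_(N, M)) (sigma2 : R)
    (y : 'cV[R[i]]_N) (j i : 'I_M) : R[i] :=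
  ((filter_vec H sigma2 j i)^t* *m y) 0 0.

Definition gain (R : realType) (N M : nat) (H : 'M[R[i]]_(N, M)) (sigma2 : R)
    (j i k : 'I_M) : R[i] :=
  ((col j H)^t* *m invmx (covmx H sigma2 [set j; i]) *m col k H) 0 0.

(* $\sigma^2_{j|i} = a_{j|i,j}$ as an element of R: the gain is real and
   positive, see [gain_var] and [cond_var_gt0]. *)
Definition cond_var (R : realType) (N M : nat) (H : 'M[R[i]]_(N, M))
    (sigma2 : R) (j i : 'I_M) : R :=
  complex.Re (gain H sigma2 j i j).

Definition obs_re (R : realType) (N M : nat) (H : 'M[R[i]]_(N, M)) (sigma2 : R)
    (y : 'cV[R[i]]_N) (j i : 'I_M) : R :=
  complex.Re (obs H sigma2 y j i).

Definition coef_c (R : realType) (N M : nat) (H : 'M[R[i]]_(N, M)) (sigma2 : R)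
    (j i : 'I_M) : R :=
  2 / cond_var H sigma2 j i
  * complex.Re ((gain H sigma2 j i j)^* * gain H sigma2 j i i).

Definition coef_d (R : realType) (N M : nat) (H : 'M[R[i]]_(N, M)) (sigma2 : R)
    (y : 'cV[R[i]]_N) (j i : 'I_M) : R :=
  2 / cond_var H sigma2 j i
  * complex.Re ((gain H sigma2 j i i)^* * obs H sigma2 y j i).

Definition llr_step (R : realType) (N M : nat) (H : 'M[R[i]]_(N, M))
    (sigma2 : R) (y : 'cV[R[i]]_N) (la : 'I_M -> R) (j i : 'I_M) (l : R) : R :=
  la j + 4 * obs_re H sigma2 y j i
  - zeta (l + 2 * coef_d H sigma2 y j i) (coef_c H sigma2 j i).

Definition fwd_step (R : realType) (N M : nat) (H : 'M[R[i]]_(N, M))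
    (sigma2 : R) (y : 'cV[R[i]]_N) (la : 'I_M -> R) (j : 'I_M) : R -> R :=
  llr_step H sigma2 y la j (ord_pred j).

Definition bwd_step (R : realType) (N M : nat) (H : 'M[R[i]]_(N, M))
    (sigma2 : R) (y : 'cV[R[i]]_N) (la : 'I_M -> R) (j : 'I_M) : R -> R :=
  llr_step H sigma2 y la j (ordS j).

(* [traject ord_pred j M] is j, j - 1, .., j + 1 (modulo M), hence this is
   g_j \o g_{j-1} \o .. \o g_{j+1}. *)
Definition fwd_turn (R : realType) (N M : nat) (H : 'M[R[i]]_(N, M))
    (sigma2 : R) (y : 'cV[R[i]]_N) (la : 'I_M -> R) (j : 'I_M) (l : R) : R :=
  foldr (fwd_step H sigma2 y la) l (traject (@ord_pred M) j M).

(* Likewise g_j \o g_{j+1} \o .. \o g_{j-1}, with the backward steps g. *)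
Definition bwd_turn (R : realType) (N M : nat) (H : 'M[R[i]]_(N, M))
    (sigma2 : R) (y : 'cV[R[i]]_N) (la : 'I_M -> R) (j : 'I_M) (l : R) : R :=
  foldr (bwd_step H sigma2 y la) l (traject (@ordS M) j M).

Definition converges_to_unique_fixpoint (R : realType) (f : R -> R) : Prop :=
  exists l : R,
    [/\ f l = l,
        forall l' : R, f l' = l' -> l' = l
      & forall l0 : R, (fun k : nat => iter k f l0) @ \oo --> l].

Section CovarianceFacts.
Variables (R : realType) (N M : nat) (H : 'M[R[i]]_(N, M)) (sigma2 : R).
Hypothesis sigma2_gt0 : 0 < sigma2.

Let quad_ge0 n (v : 'cV[R[i]]_n) : 0 <= (v^t* *m v) 0 0.
Proof.
rewrite mxE; apply: sumr_ge0 => k _.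
by rewrite !mxE mulrC; apply: mul_conjC_ge0.
Qed.

Let quad_gt0 n (v : 'cV[R[i]]_n) : v != 0 -> 0 < (v^t* *m v) 0 0.
Proof.
move=> v0; rewrite lt_def quad_ge0 andbT.
apply: contra v0 => /eqP q0; apply/eqP/matrixP => k l; rewrite (ord1 l) mxE.
have term_ge0 m : true -> 0 <= v^t* 0 m * v m 0.
  by move=> _; rewrite !mxE mulrC; apply: mul_conjC_ge0.
have sum0 : \sum_m v^t* 0 m * v m 0 == 0 by move: q0; rewrite mxE => /eqP.
move: sum0; rewrite psumr_eq0 // => /allP/(_ k (mem_index_enum k)) /=.
by rewrite !mxE mulrC mul_conjC_eq0 => /eqP.
Qed.

Let covmx_quad_gt0 (Phi : {set 'I_M}) (v : 'cV[R[i]]_N) :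
  v != 0 -> 0 < (v^t* *m covmx H sigma2 Phi *m v) 0 0.
Proof.
move=> v0; rewrite /covmx mulmxDr mulmxDl mxE; apply: ltr_wpDr.
  rewrite mulmx_sumr mulmx_suml summxE; apply: sumr_ge0 => k _.
  have -> : v^t* *m (col k H *m (col k H)^t*) *m v
            = ((col k H)^t* *m v)^t* *m ((col k H)^t* *m v).
    by rewrite trmx_mul map_mxM trmxCK !mulmxA.
  exact: quad_ge0.
rewrite mul_mx_scalar -scalemxAl mxE mulr_gt0 ?quad_gt0 //.
by rewrite ltcR.
Qed.

Lemma covmx_unit (Phi : {set 'I_M}) : covmx H sigma2 Phi \in unitmx.
Proof.
rewrite -unitmx_tr -row_free_unit -kermx_eq0; apply/negP => /negP /rowV0Pn[u].
move/sub_kermxP => uK u0.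
have Ku : covmx H sigma2 Phi *m u^T = 0.
  by apply: trmx_inj; rewrite trmx_mul trmxK uK trmx0.
have uT0 : u^T != 0 by rewrite -trmx0 (inj_eq (@trmx_inj _ _ _)).
by have := covmx_quad_gt0 Phi uT0; rewrite -mulmxA Ku mulmx0 mxE ltxx.
Qed.

Let covmx_herm (Phi : {set 'I_M}) :
  (covmx H sigma2 Phi)^t* = covmx H sigma2 Phi.
Proof.
rewrite /covmx linearD map_mxD /= tr_scalar_mx map_scalar_mx /=.
have -> : Num.conj sigma2%:C = sigma2%:C by apply: conjc_real.
congr (_ + _).
rewrite linear_sum map_mx_sum; apply: eq_bigr => k _ /=.
by rewrite trmx_mul map_mxM trmxCK.
Qed.

Let gain_gt0 (j i : 'I_M) : col j H != 0 -> 0 < gain H sigma2 j i j.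
Proof.
move=> hj; rewrite /gain; set K := covmx _ _ _.
have Ku : K \in unitmx by apply: covmx_unit.
have hE : col j H = K *m filter_vec H sigma2 j i by rewrite mulKVmx.
have w0 : filter_vec H sigma2 j i != 0.
  by apply: contra hj => /eqP w0; rewrite hE w0 mulmx0.
rewrite [in X in 0 < X]hE trmx_mul map_mxM covmx_herm -!mulmxA.
by rewrite (mulKmx Ku) mulmxA; apply: covmx_quad_gt0.
Qed.

Lemma cond_var_gt0 (j i : 'I_M) : col j H != 0 -> 0 < cond_var H sigma2 j i.
Proof. by move=> /(gain_gt0 i); rewrite /cond_var ltcE => /andP[]. Qed.

Lemma gain_var (j i : 'I_M) :
  col j H != 0 -> gain H sigma2 j i j = (cond_var H sigma2 j i)%:C.
Proof.
move=> /(gain_gt0 i); rewrite /cond_var ltcE => /andP[/eqP + _].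
by case: (gain _ _ _ _ _) => a b /= ->.
Qed.

End CovarianceFacts.

(* Main.v *)
(* The derivative of zeta(.; c) is sinh(2c) / (cosh x + cosh(2c)), whose
   absolute value is largest at x = 0, where it equals tanh|c| < 1.  So each
   step of the recursion is a contraction, whatever the values of the
   coefficients, and so is a full turn; Banach's fixed-point theorem applies. *)

Require Import Defs.
From mathcomp Require Import all_boot all_order all_algebra.
From mathcomp Require Import all_classical all_reals all_analysis.
From mathcomp Require Import complex.
From mathcomp Require Import ring lra.

Import Order.TTheory GRing.Theory Num.Theory.
Import numFieldNormedType.Exports.
Local Open Scope ring_scope.
Local Open Scope complex_scope.

Lemma zetaE (R : realType) (x c : R) :
  zeta x c = ln (expR (x / 2 + c) + expR (- x / 2 - c))
             - ln (expR (x / 2 - c) + expR (- x / 2 + c)).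
Proof. by rewrite /zeta ln_div ?posrE ?addr_gt0 ?expR_gt0 // opprB. Qed.

(** The function is ln(2 cosh(x/2 + a)), with derivative tanh(x/2 + a)/2; [zeta] is its instance at
    a = c minus its instance at a = -c. *)
Lemma is_derive_ln_cosh (R : realType) (a x : R) :
  is_derive x 1 (fun x : R => ln (expR (x / 2 + a) + expR (- x / 2 - a)))
    ((expR (x / 2 + a) - expR (- x / 2 - a))
     / (2 * (expR (x / 2 + a) + expR (- x / 2 - a)))).
Proof.
have pos : 0 < expR (x / 2 + a) + expR (- x / 2 - a).
  by rewrite addr_gt0 ?expR_gt0.
have dexp (s b : R) : is_derive x 1 (fun x : R => expR (s * x / 2 + b))
    (s / 2 * expR (s * x / 2 + b)).
  have daff : is_derive x 1 (fun x : R => s * x / 2 + b) (s / 2).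
    have -> : (fun x : R => s * x / 2 + b) = (s / 2) \*: (@id R) + cst b.
      by apply/funext => z; change (s * z / 2 + b = s / 2 * z + b); ring.
    by apply: is_derive_eq; exact: etrans (addr0 _) (mulr1 _).
  by rewrite mulrC; exact: is_derive1_comp.
have dsum : is_derive x 1 (fun x : R => expR (x / 2 + a) + expR (- x / 2 - a))
    ((expR (x / 2 + a) - expR (- x / 2 - a)) / 2).
  have := is_deriveD (dexp 1 a) (dexp (-1) (- a)).
  have -> : (fun x : R => expR (1 * x / 2 + a))
      + (fun x : R => expR (-1 * x / 2 - a)) =
      (fun x : R => expR (x / 2 + a) + expR (- x / 2 - a)).
    by apply/funext => z; rewrite /GRing.add /= mul1r mulN1r.
  by move/is_derive_eq; apply; rewrite !(mul1r, mulNr); field.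
have dln := is_derive1_ln pos.
have dcomp := @is_derive1_comp _ (@ln R)
  (fun x => expR (x / 2 + a) + expR (- x / 2 - a)) x _ _ dln dsum.
apply: (is_derive_eq dcomp).
by field; rewrite gt_eqF.
Qed.

(** With u = x/2 + c and v = x/2 - c, this is (tanh u - tanh v)/2 = sinh(u - v)/(cosh(u + v) +
    cosh(u - v)). *)
Lemma is_derive_zeta (R : realType) (c x : R) :
  is_derive x 1 (fun x => zeta x c)
    ((expR (2 * c) - expR (- (2 * c)))
     / (expR x + expR (- x) + expR (2 * c) + expR (- (2 * c)))).
Proof.
have -> : (fun x => zeta x c) =
    (fun x => ln (expR (x / 2 + c) + expR (- x / 2 - c)))
    - (fun x => ln (expR (x / 2 - c) + expR (- x / 2 - - c))).
  by apply/funext => z; rewrite zetaE opprK.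
apply: (is_derive_eq
  (is_deriveB (is_derive_ln_cosh R c x) (is_derive_ln_cosh R (- c) x))).
rewrite opprK.
(* Every exponential is a Laurent monomial in [t] and [b], so an identity of rational functions
   remains. *)
set t := expR (x / 2); set b := expR c.
have t0 : 0 < t by exact: expR_gt0.
have b0 : 0 < b by exact: expR_gt0.
have -> : expR x = t ^+ 2 by rewrite /t expr2 -expRD; congr expR; lra.
have -> : expR (- x) = t^-1 ^+ 2.
  by rewrite /t expr2 -expRN -expRD; congr expR; lra.
have -> : expR (2 * c) = b ^+ 2 by rewrite /b expr2 -expRD; congr expR; lra.
have -> : expR (- (2 * c)) = b^-1 ^+ 2.
  by rewrite /b expr2 -expRN -expRD; congr expR; lra.
have -> : - x / 2 = - (x / 2) by lra.
rewrite !expRD !expRN -/t -/b.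
field.
by rewrite !gt_eqF // !(addr_gt0, mulr_gt0, exprn_gt0, ltr01).
Qed.

(** Mean value theorem; the factor is the absolute derivative at 0, that is tanh|c|. *)
Lemma norm_zetaB_le (R : realType) (c x z : R) :
  `|zeta x c - zeta z c| <=
  `|expR (2 * c) - expR (- (2 * c))| / (2 + expR (2 * c) + expR (- (2 * c)))
  * `|x - z|.
Proof.
wlog zx : x z / z <= x.
  move=> ih; have /orP[/ih//|/ih] := le_total z x.
  by rewrite distrC [X in _ * X]distrC.
have [|w _ ->] := MVT_segment zx (fun w _ => is_derive_zeta R c w).
  apply: continuous_subspaceT => w; apply: differentiable_continuous.
  by apply/derivable1_diffP; apply: ex_derive; exact: is_derive_zeta.
rewrite normrM ler_wpM2r // normrM ler_wpM2l // normfV.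
have e1 := expR_gt0 (2 * c); have e2 := expR_gt0 (- (2 * c)).
have e3 := expR_gt0 w; have e4 := expR_gt0 (- w).
rewrite ger0_norm; last by rewrite !addr_ge0 // ltW.
rewrite lef_pV2 ?posrE ?addr_gt0 //.
rewrite !lerD2r.
(* [2 <= expR w + expR (- w)] by AM-GM *)
have : expR w * expR (- w) = 1 by rewrite -expRD subrr expR0.
have := sqr_ge0 (expR w - expR (- w)).
nra.
Qed.

(** The factor is uniform in [x] and [z]: strict decrease of distances alone would not force a fixed
    point. It may vary from one step of the ring to another. *)
Definition contracts {R : realType} (f : R -> R) : Prop :=
  exists2 q : R, 0 <= q < 1 & forall x z, `|f x - f z| <= q * `|x - z|.

(** Banach's theorem on the closed set [setT] gives existence; uniqueness and convergence follow
    from the Lipschitz bound. *)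
Lemma contracts_fixpoint (R : realType) (f : R -> R) :
  contracts f -> converges_to_unique_fixpoint f.
Proof.
move=> [q /andP[q0 q1] lipf].
have iterf n x z : `|iter n f x - iter n f z| <= q ^+ n * `|x - z|.
  elim: n => [|n IHn]; first by rewrite mul1r.
  by rewrite /= (le_trans (lipf _ _)) // exprS -mulrA ler_wpM2l.
have [p fp] : exists p, f p = p.
  have funf : set_fun setT setT f by [].
  have [|||p _ pE] := @banach_fixed_point R R setT (mkfun funf).
  - exists (NngNum q0); split => //= -[x z] _; exact: lipf.
  - exact: closedT.
  - by exists 0.
  by exists p; rewrite {2}pE.
exists p; split=> //.
- move=> z fz; apply/eqP; rewrite -subr_eq0 -normr_eq0.
  (* Two fixed points satisfy |z - p| <= q |z - p| with q < 1. *)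
  have := lipf z p; rewrite fz fp.
  have := normr_ge0 (z - p) => n0 ?; apply/eqP; nra.
- move=> x0.
  have iterp n : iter n f p = p by elim: n => //= n ->.
  apply/cvgrPdist_lt => e e0.
  have q1' : `|q| < 1 by rewrite ger0_norm.
  have /cvgrPdist_lt/(_ e e0) := cvg_geometric `|p - x0| q1'.
  apply: filterS => n.
  rewrite sub0r normrN /= ger0_norm ?mulr_ge0 ?exprn_ge0 //.
  (* Reading [p] as its own [n]-th iterate turns the error into a distance between two orbits. *)
  apply: le_lt_trans; rewrite -{1}(iterp n) mulrC.
  exact: iterf.
Qed.

Lemma contracts_comp (R : realType) (f g : R -> R) :
  contracts f -> contracts g -> contracts (f \o g).
Proof.
move=> [q /andP[q0 q1] lipf] [r /andP[r0 r1] lipg]; exists (q * r) => [|x z].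
  by rewrite mulr_ge0 // mulr_ilt1.
by rewrite -mulrA (le_trans (lipf _ _)) // ler_wpM2l.
Qed.

(** The list is nonempty because an empty fold is the identity, which does not contract. *)
Lemma contracts_foldr (R : realType) (I : Type) (g : I -> R -> R) (i : I)
    (s : seq I) :
  (forall i, contracts (g i)) -> contracts (fun l => foldr g l (i :: s)).
Proof.
move=> cg; elim: s i => [|k s IHs] i; first exact: cg.
exact: contracts_comp (cg i) (IHs k).
Qed.

Lemma contracts_llr_step (R : realType) (N M : nat) (H : 'M[R[i]]_(N, M))
    (sigma2 : R) (y : 'cV[R[i]]_N) (la : 'I_M -> R) (j i : 'I_M) :
  contracts (llr_step H sigma2 y la j i).
Proof.
set c := coef_c H sigma2 j i.
exists (`|expR (2 * c) - expR (- (2 * c))|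
        / (2 + expR (2 * c) + expR (- (2 * c)))) => [|x z].
  have e1 := expR_gt0 (2 * c); have e2 := expR_gt0 (- (2 * c)).
  have e3 : 0 < 2 + expR (2 * c) + expR (- (2 * c)) by lra.
  (* The factor is below 1 since |a - b| < 2 + a + b for positive a and b. *)
  rewrite divr_ge0 ?(ltW e3) //= ltr_pdivrMr // mul1r ltr_norml.
  by apply/andP; split; lra.
rewrite /llr_step -/c.
(* The offset and the shift cancel in differences, so their values are abstracted away. *)
move: (la j + _) (2 * _) c => A d c.
have -> : A - zeta (x + d) c - (A - zeta (z + d) c)
    = zeta (z + d) c - zeta (x + d) c by ring.
by rewrite distrC (le_trans (norm_zetaB_le _ _ _ _)) // opprD addrACA subrr addr0.
Qed.

Theorem theorem3 (R : realType) (N M : nat) (H : 'M[R[i]]_(N, M)) (sigma2 : R)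
    (y : 'cV[R[i]]_N) (la : 'I_M -> R) :
  (2 <= M)%N -> (M <= N)%N ->
  (forall j : 'I_M, col j H != 0) ->
  0 < sigma2 ->
  forall j : 'I_M,
    converges_to_unique_fixpoint (fwd_turn H sigma2 y la j) /\
    converges_to_unique_fixpoint (bwd_turn H sigma2 y la j).
Proof.
(* With a successor as length, [traject] reduces to a list with head [j], as [contracts_foldr]
   requires. *)
case: M H la => [//|M] H la _ _ _ _ j.
split; apply: contracts_fixpoint; apply: contracts_foldr => k;
  exact: contracts_llr_step.
Qed.
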